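(* Let $m,n\geq 7$ be integers. Then there exists a set $\mathcal{S}$ of mutually orthogonal pure product states (i.e. an orthogonal set without entanglement) in $\mathbb{C}^m\otimes\mathbb{C}^n$ which has genuine hidden nonlocality of type II.
   Context: States are nonzero vectors, possibly unnormalized, in a bipartite space $\mathcal{H}_A\otimes\mathcal{H}_B$, with Alice holding $\mathcal{H}_A$ and Bob holding $\mathcal{H}_B$. A pure state is a product state if it has the form $|a\rangle\otimes|b\rangle$; a set is without entanglement if all its elements are product states. **Local distinguishability.** A finite set of mutually orthogonal states is *locally distinguishable* if there is a protocol of local operations and classical communication (LOCC), i.e. a sequence of local quantum measurements by Alice and Bob, each chosen depending on all previously communicated outcomes, that identifies with certainty which state of the (known) set was prepared. Otherwise it is *locally indistinguishable*. **Orthogonality-preserving local measurement (OPLM).** A local measurement is given by Kraus operators $K_\mu$ acting locally: Alice and/or Bob perform a measurement on their own system, so $K_\mu=M_a\otimes N_b$ with $\mu=(a,b)$, $\sum_a M_a^\dagger M_a=\mathbb{I}$, $\sum_b N_b^\dagger N_b=\mathbb{I}$ (a party doing nothing has the single operator $\mathbb{I}$). For a set $\mathcal{S}$ and an outcome $\mu$, the set of post-measurement states is $\mathcal{S}'_\mu=\{K_\mu|\psi\rangle : |\psi\rangle\in\mathcal{S},\ K_\mu|\psi\rangle\neq 0\}$. The measurement is an OPLM for $\mathcal{S}$ if for every outcome $\mu$ the vectors $K_\mu|\psi\rangle$, $|\psi\rangle\in\mathcal{S}$, are mutually orthogonal. Always $|\mathcal{S}'_\mu|\le|\mathcal{S}|$.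 **Local redundancy.** An orthogonal set $\mathcal{S}$ is *locally redundant* if it remains orthogonal after discarding one or more subsystems. Here each party's space may be identified, through an arbitrary local unitary, with a tensor product of smaller spaces (e.g. $\mathbb{C}^d\cong\bigotimes_i\mathbb{C}^{p_i}$ where $d=\prod_i p_i$ with $p_i$ prime), and discarding means taking the partial trace over a nonempty collection of these tensor factors (of Alice's and/or Bob's space); remaining orthogonal means that the resulting reduced density operators of distinct elements of $\mathcal{S}$ are pairwise orthogonal for the inner product $\langle\rho,\sigma\rangle=\mathrm{Tr}[\rho^\dagger\sigma]$. Otherwise $\mathcal{S}$ is *locally irredundant*. **Genuine hidden nonlocality of type II.** $\mathcal{S}$ has this property if $\mathcal{S}$ is locally distinguishable and locally irredundant, and there is some OPLM such that for each outcome $\mu$ the set of post-measurement states $\mathcal{S}'_\mu$ is locally indistinguishable and, in addition, there is some outcome $\mu$ with $|\mathcal{S}'_\mu|<|\mathcal{S}|$. *)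

(* Defs.v *)
From HB Require Import structures.
From mathcomp Require Import all_boot all_order all_algebra.
From mathcomp Require Export finmap complex mxtens reals.

Set Implicit Arguments.
Unset Strict Implicit.
Unset Printing Implicit Defensive.

Import Order.TTheory GRing.Theory Num.Theory.
Local Open Scope ring_scope.
Local Open Scope fset_scope.
Local Open Scope sesquilinear_scope.

(* C^m (x) C^n is 'cV[C]_(m * n), with |a> (x) |b> the Kronecker product
   a *t b; the basis vector |i>|j> has index mxtens_index (i, j). *)

Section Nonlocality.
Variable C : numClosedFieldType.

(* On column vectors this is <u|v>, on operators Tr (X^dagger Y). *)
Definition hsdot p q (X Y : 'M[C]_(p, q)) : C := \tr (X^t* *m Y).

Definition orthogonal_states d (S : {fset 'cV[C]_d}) : Prop :=
  0 \notin S /\ {in S &, forall psi phi, psi != phi -> hsdot psi phi = 0}.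

Definition product_state m n (psi : 'cV[C]_(m * n)) : Prop :=
  exists (a : 'cV[C]_m) (b : 'cV[C]_n), psi = a *t b.

Record measurement (d : nat) := Measurement {
  outcomes : nat;
  kraus : 'I_outcomes -> 'M[C]_d;
  kraus_complete : \sum_a (kraus a)^t* *m kraus a = 1%:M
}.
Arguments kraus {d} M a : rename.

(* A finite-round LOCC protocol: the measuring party and its measurement depend
   on the branch, i.e. on all previously communicated outcomes; each branch ends
   by announcing a state. *)
Inductive protocol (m n : nat) : Type :=
| Announce (phi : 'cV[C]_(m * n))
| Alice (M : measurement m) (next : 'I_(outcomes M) -> protocol m n)
| Bob (N : measurement n) (next : 'I_(outcomes N) -> protocol m n).

(* [identifies P psi v]: when [psi] was prepared and the current unnormalized
   state is [v], every branch of [P] of nonzero probability announces [psi]. *)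
Fixpoint identifies m n (P : protocol m n) (psi v : 'cV[C]_(m * n)) : Prop :=
  match P with
  | Announce phi => v != 0 -> phi = psi
  | Alice M next =>
      forall a, identifies (next a) psi ((kraus M a *t (1%:M : 'M[C]_n)) *m v)
  | Bob N next =>
      forall b, identifies (next b) psi (((1%:M : 'M[C]_m) *t kraus N b) *m v)
  end.

Definition locally_distinguishable m n (S : {fset 'cV[C]_(m * n)}) : Prop :=
  exists P : protocol m n, {in S, forall psi, identifies P psi psi}.

Definition post_states d (K : 'M[C]_d) (S : {fset 'cV[C]_d}) :
    {fset 'cV[C]_d} :=
  [fset K *m psi | psi in S & K *m psi != 0].

(* A party doing nothing is the one-outcome measurement with operator 1%:M. *)
Definition kraus_pair m n (M : measurement m) (N : measurement n)
    (a : 'I_(outcomes M)) (b : 'I_(outcomes N)) : 'M[C]_(m * n) :=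
  kraus M a *t kraus N b.
Arguments kraus_pair {m n} M N a b.

Definition OPLM m n (M : measurement m) (N : measurement n)
    (S : {fset 'cV[C]_(m * n)}) : Prop :=
  forall a b, {in S &, forall psi phi, psi != phi ->
    hsdot (kraus_pair M N a b *m psi) (kraus_pair M N a b *m phi) = 0}.

(* Partial trace over the factors C^da and C^db of
   (C^ka (x) C^da) (x) (C^kb (x) C^db). *)
Definition ptrace ka da kb db (X : 'M[C]_((ka * da) * (kb * db))) :
    'M[C]_(ka * kb) :=
  \matrix_(i, j) \sum_(x < da) \sum_(y < db)
    X (mxtens_index (mxtens_index ((mxtens_unindex i).1, x),
                     mxtens_index ((mxtens_unindex i).2, y)))
      (mxtens_index (mxtens_index ((mxtens_unindex j).1, x),
                     mxtens_index ((mxtens_unindex j).2, y))).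

Definition reduced m n ka da kb db
    (U : 'M[C]_(ka * da, m)) (V : 'M[C]_(kb * db, n))
    (psi : 'cV[C]_(m * n)) : 'M[C]_(ka * kb) :=
  let v : 'cV[C]_((ka * da) * (kb * db)) := (U *t V) *m psi in
  ptrace (v *m v^t*).

(* U identifies C^m with C^ka (x) C^da, where C^da is the product of the
   discarded tensor factors of Alice and C^ka that of the kept ones; da = 1 if
   she discards nothing, ka = 1 if she discards everything. Same for Bob. *)
Definition locally_redundant m n (S : {fset 'cV[C]_(m * n)}) : Prop :=
  exists (ka da kb db : nat)
         (U : 'M[C]_(ka * da, m)) (V : 'M[C]_(kb * db, n)),
    [/\ (ka * da = m)%N /\ U \is unitarymx,
        (kb * db = n)%N /\ V \is unitarymx,
        (1 < da)%N \/ (1 < db)%N &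
        {in S &, forall psi phi, psi != phi ->
           hsdot (reduced U V psi) (reduced U V phi) = 0}].

Definition genuine_hidden_nonlocality_II m n (S : {fset 'cV[C]_(m * n)}) :
    Prop :=
  [/\ locally_distinguishable S,
      ~ locally_redundant S &
      exists (M : measurement m) (N : measurement n),
        [/\ OPLM M N S,
            forall a b,
              ~ locally_distinguishable
                  (post_states (kraus_pair M N a b) S) &
            exists a b,
              (#|` post_states (kraus_pair M N a b) S| < #|` S|)%N]].

End Nonlocality.

(* Main.v *)
Require Import Defs.
From mathcomp Require Import all_boot all_order all_algebra.

(** Write e_k for the basis kets.  The eight domino states
      e_0 (e_1 +- e_0), e_2 (e_1 +- e_2), (e_1 +- e_2) e_0, (e_1 +- e_0) e_2
    of C^3 (x) C^3 are locally indistinguishable: orthogonality after a local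
    outcome K forces the Gram matrix of K e_0, K e_1, K e_2 to be scalar, so
    along some branch of the protocol the states never come apart.
    On Alice's span of e_0, ..., e_5 each state is doubled into a flagged one:
      (e_0 + e_3) (e_1 +- e_0), (e_2 + e_5) (e_1 +- e_2),
      (e_1 + e_4 +- (e_2 - e_5)) e_0, (e_1 + e_4 +- (e_0 - e_3)) e_2.
    The flags make Alice's vectors orthogonal between the states in which Alice
    and those in which Bob must measure first, so LOCC succeeds; but either
    outcome of Alice's test k < 3 erases the flag and leaves domino
    states.  Adding the row of all e_k e_3 and the column of all e_6 e_k keeps
    the set distinguishable and makes it irredundant: the reductions of m states
    sharing Bob's vector would be nonzero with orthogonal ranges in C^ka, so
    m <= ka.  The state e_6 e_3 is annihilated by the outcome k < 3. *)

Set Implicit Arguments.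
Unset Strict Implicit.
Unset Printing Implicit Defensive.

Import Order.TTheory GRing.Theory Num.Theory.
Local Open Scope ring_scope.
Local Open Scope sesquilinear_scope.

Arguments kraus {C d} M a : rename.
Arguments kraus_pair {C m n} M N a b : rename.

Section LocalDiscrimination.
Variable C : numClosedFieldType.

(** * Adjoints, Kronecker products and the Hilbert-Schmidt inner product *)

Lemma adjmxM m n p (A : 'M[C]_(m, n)) (B : 'M[C]_(n, p)) :
  (A *m B)^t* = B^t* *m A^t*.
Proof. by rewrite trmx_mul map_mxM. Qed.

Lemma adj_tensmx m n p q (A : 'M[C]_(m, n)) (B : 'M[C]_(p, q)) :
  (A *t B)^t* = A^t* *t B^t*.
Proof. by rewrite trmx_tens map_mxT. Qed.

Lemma mxtrace_tens m n (A : 'M[C]_m) (B : 'M[C]_n) :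
  \tr (A *t B) = \tr A * \tr B.
Proof.
rewrite /mxtrace mulr_sum; apply: eq_bigr => k _.
by case: (mxtens_indexP k) => i j; rewrite tensmxE mxtens_indexK.
Qed.

Lemma hsdotE p q (X Y : 'M[C]_(p, q)) :
  hsdot X Y = \sum_i \sum_j (X j i)^* * Y j i.
Proof.
rewrite /hsdot /mxtrace; apply: eq_bigr => i _; rewrite mxE.
by apply: eq_bigr => j _; rewrite !mxE.
Qed.

Lemma hsdotC p q (X Y : 'M[C]_(p, q)) : hsdot Y X = (hsdot X Y)^*.
Proof.
rewrite !hsdotE rmorph_sum; apply: eq_bigr => i _ /=.
rewrite rmorph_sum; apply: eq_bigr => j _ /=.
by rewrite rmorphM /= conjCK mulrC.
Qed.

Lemma hsdotC_eq0 p q (X Y : 'M[C]_(p, q)) : hsdot X Y = 0 -> hsdot Y X = 0.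
Proof. by move=> XY0; rewrite hsdotC XY0 conjC0. Qed.

Lemma hsdotDr p q (X Y Z : 'M[C]_(p, q)) : hsdot X (Y + Z) = hsdot X Y + hsdot X Z.
Proof. by rewrite /hsdot mulmxDr mxtraceD. Qed.

Lemma hsdotNr p q (X Y : 'M[C]_(p, q)) : hsdot X (- Y) = - hsdot X Y.
Proof. by rewrite /hsdot mulmxN linearN. Qed.

Lemma hsdotDl p q (X Y Z : 'M[C]_(p, q)) : hsdot (X + Y) Z = hsdot X Z + hsdot Y Z.
Proof. by rewrite hsdotC hsdotDr rmorphD /= -!hsdotC. Qed.

Lemma hsdotNl p q (X Y : 'M[C]_(p, q)) : hsdot (- X) Y = - hsdot X Y.
Proof. by rewrite hsdotC hsdotNr rmorphN /= -hsdotC. Qed.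

Definition hsdot_expand := (hsdotDr, hsdotDl, hsdotNr, hsdotNl).

Lemma hsdot0r p q (X : 'M[C]_(p, q)) : hsdot X 0 = 0.
Proof. by rewrite /hsdot mulmx0 mxtrace0. Qed.

Lemma hsdot0l p q (X : 'M[C]_(p, q)) : hsdot 0 X = 0.
Proof. by rewrite hsdotC hsdot0r conjC0. Qed.

Lemma hsdot_eq0 p q (X : 'M[C]_(p, q)) : (hsdot X X == 0) = (X == 0).
Proof.
apply/eqP/eqP => [|->]; last exact: hsdot0r.
rewrite hsdotE => XX0; apply/matrixP => i j; rewrite [RHS]mxE.
have pos a b : 0 <= (X a b)^* * X a b by rewrite mulrC mul_conjC_ge0.
have /(_ j isT) col0 := psumr_eq0P (fun j _ => sumr_ge0 _ (fun i _ => pos i j)) XX0.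
have /(_ i isT) := psumr_eq0P (fun i _ => pos i j) col0.
by move/eqP; rewrite mulrC mul_conjC_eq0 => /eqP.
Qed.

Lemma hsdot_neq p q (X Y : 'M[C]_(p, q)) :
  hsdot X X != 0 -> hsdot X Y = 0 -> X != Y.
Proof. by move=> X0 XY0; apply: contraNneq X0 => {2}->; rewrite XY0. Qed.

Lemma hsdot_adj p q r (A : 'M[C]_(p, q)) (X : 'M_(q, r)) Y :
  hsdot (A *m X) Y = hsdot X (A^t* *m Y).
Proof. by rewrite /hsdot adjmxM mulmxA. Qed.

Lemma hsdot_tens m n p q (A A' : 'M[C]_(m, n)) (B B' : 'M[C]_(p, q)) :
  hsdot (A *t B) (A' *t B') = hsdot A A' * hsdot B B'.
Proof. by rewrite /hsdot adj_tensmx tensmx_mul mxtrace_tens. Qed.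

Lemma hsdot_prod m n (a a' : 'cV[C]_m) (b b' : 'cV[C]_n) :
  hsdot (a *t b : 'cV_(m * n)) (a' *t b') = hsdot a a' * hsdot b b'.
Proof. exact: (@hsdot_tens m 1 n 1). Qed.

Lemma tensmx_prod k l m n (A : 'M[C]_(k, m)) (B : 'M[C]_(l, n))
    (a : 'cV[C]_m) (b : 'cV[C]_n) :
  (A *t B) *m (a *t b : 'cV_(m * n)) = (A *m a) *t (B *m b).
Proof. exact: (@tensmx_mul _ k m l n 1 1). Qed.

(** * Completeness relations and the states reached along a protocol *)

(** Insert the completeness relation between [X] and [Y]. It serves two purposes: orthogonality
    after every outcome gives orthogonality before the measurement, and a nonzero vector survives
    some outcome. *)
Lemma hsdot_kraus d (M : measurement C d) p (X Y : 'M_(d, p)) :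
  hsdot X Y = \sum_a hsdot (kraus M a *m X) (kraus M a *m Y).
Proof.
rewrite -[Y in LHS]mul1mx -(kraus_complete M) mulmx_suml /hsdot mulmx_sumr.
rewrite linear_sum; apply: eq_bigr => a _ /=.
by rewrite adjmxM !mulmxA.
Qed.

Lemma tens_1mx m n : (1%:M : 'M[C]_m) *t (1%:M : 'M[C]_n) = 1%:M.
Proof.
apply/matrixP => k l; case: (mxtens_indexP k) => i j; case: (mxtens_indexP l) => i' j'.
by rewrite tensmxE !mxE (can_eq (@mxtens_indexK _ _)) xpair_eqE mulr_natr mulrb; case: eqP; case: eqP.
Qed.

Lemma tensmx_suml m n p q I (r : seq I) (F : I -> 'M[C]_(m, n)) (B : 'M[C]_(p, q)) :
  (\sum_(i <- r) F i) *t B = \sum_(i <- r) F i *t B.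
Proof.
elim/big_rec2: _ => [|i y x _ <-]; first by rewrite tens0mx.
by apply/matrixP => k l; rewrite !mxE mulrDl.
Qed.

Lemma tensmx_sumr m n p q I (r : seq I) (A : 'M[C]_(m, n)) (F : I -> 'M[C]_(p, q)) :
  A *t (\sum_(i <- r) F i) = \sum_(i <- r) A *t F i.
Proof.
elim/big_rec2: _ => [|i y x _ <-]; first by rewrite tensmx0.
by apply/matrixP => k l; rewrite !mxE mulrDr.
Qed.

Lemma alice_complete m n (M : measurement C m) :
  \sum_a (kraus M a *t (1%:M : 'M[C]_n))^t* *m (kraus M a *t 1%:M) = 1%:M.
Proof.
under eq_bigr do rewrite adj_tensmx tensmx_mul trmx1 map_mx1 mulmx1.
by rewrite -tensmx_suml kraus_complete tens_1mx.
Qed.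

Lemma bob_complete m n (N : measurement C n) :
  \sum_b ((1%:M : 'M[C]_m) *t kraus N b)^t* *m (1%:M *t kraus N b) = 1%:M.
Proof.
under eq_bigr do rewrite adj_tensmx tensmx_mul trmx1 map_mx1 mulmx1.
by rewrite -tensmx_sumr kraus_complete tens_1mx.
Qed.

Lemma identifies0 m n (P : protocol C m n) psi : identifies P psi 0.
Proof.
elim: P => [phi|M next IH|N next IH] /=; first by rewrite eqxx.
  by move=> a; rewrite mulmx0.
by move=> b; rewrite mulmx0.
Qed.

(** At a leaf, two nonzero vectors would force one announcement to equal both [psi] and [phi], so
    one of them vanishes. Orthogonality then travels back from the leaves to the root through the
    completeness relations. *)
Lemma identifies_orthogonal m n (P : protocol C m n) psi phi v w :
  psi != phi -> identifies P psi v -> identifies P phi w -> hsdot v w = 0.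
Proof.
move=> neq; elim: P v w => [xi|M next IH|N next IH] v w /= idv idw.
- have [->|v0] := eqVneq v 0; first exact: hsdot0l.
  have [->|w0] := eqVneq w 0; first exact: hsdot0r.
  by move: neq; rewrite -(idv v0) (idw w0) eqxx.
- rewrite (hsdot_kraus (Measurement (alice_complete n M))) big1 // => a _ /=.
  exact: IH.
- rewrite (hsdot_kraus (Measurement (bob_complete m N))) big1 // => b _ /=.
  exact: IH.
Qed.

(** * Product states as pairs of factors, and the domino states *)

Definition tens m n (s : 'cV[C]_m * 'cV[C]_n) : 'cV_(m * n) := s.1 *t s.2.

Definition orth m n (s t : 'cV[C]_m * 'cV[C]_n) :=
  hsdot s.1 t.1 * hsdot s.2 t.2 == 0.

Lemma hsdot_tensE m n (s t : 'cV[C]_m * 'cV[C]_n) :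
  hsdot (tens s) (tens t) = hsdot s.1 t.1 * hsdot s.2 t.2.
Proof. exact: hsdot_prod. Qed.

Lemma tens_eq0 m n (s : 'cV[C]_m * 'cV[C]_n) :
  (tens s == 0) = (s.1 == 0) || (s.2 == 0).
Proof. by rewrite -!hsdot_eq0 hsdot_tensE mulf_eq0. Qed.

Lemma orth_sym m n (s t : 'cV[C]_m * 'cV[C]_n) : orth s t = orth t s.
Proof.
by rewrite /orth !mulf_eq0 (hsdotC s.1 t.1) (hsdotC s.2 t.2) !conjC_eq0.
Qed.

(** The triples are arbitrary vectors, not kets, because the argument follows their images under the
    Kraus operators of a branch. *)
Definition domino m n (x0 x1 x2 : 'cV[C]_m) (y0 y1 y2 : 'cV[C]_n) :=
  [:: (x0, y1 + y0); (x0, y1 - y0); (x2, y1 + y2); (x2, y1 - y2);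
      (x1 + x2, y0); (x1 - x2, y0); (x1 + x0, y2); (x1 - x0, y2)].

(** For images of an orthonormal triple this says that the map is a multiple of an isometry on its
    span; the multiple may be 0. *)
Definition equigram d (p0 p1 p2 : 'cV[C]_d) :=
  [/\ hsdot p1 p1 = hsdot p0 p0, hsdot p2 p2 = hsdot p0 p0, hsdot p0 p1 = 0,
      hsdot p0 p2 = 0 & hsdot p1 p2 = 0].

Lemma equigram_normD d (p0 p1 p2 : 'cV[C]_d) : p0 != 0 -> equigram p0 p1 p2 ->
  [/\ p2 != 0, p1 + p2 != 0, p1 - p2 != 0, p1 + p0 != 0 & p1 - p0 != 0].
Proof.
move=> p0n [n1 n2 h01 h02 h12]; move: (p0n); rewrite -!hsdot_eq0 !hsdot_expand.
rewrite n1 n2 h01 h12 !(hsdotC_eq0 h01) !(hsdotC_eq0 h12).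
by move=> c0; split=> //; rewrite ?(subr0, addr0, oppr0, opprK, add0r) -mulr2n mulrn_eq0.
Qed.

Lemma domino_orth m n (x0 x1 x2 : 'cV[C]_m) (y0 y1 y2 : 'cV[C]_n) :
  equigram x0 x1 x2 -> equigram y0 y1 y2 -> pairwise (@orth m n) (domino x0 x1 x2 y0 y1 y2).
Proof.
move=> [n1 n2 h01 h02 h12] [m1 m2 g01 g02 g12].
rewrite /= /orth /= !hsdot_expand.
rewrite h01 h02 h12 (hsdotC_eq0 h01) (hsdotC_eq0 h02) (hsdotC_eq0 h12).
rewrite g01 g02 g12 (hsdotC_eq0 g01) (hsdotC_eq0 g02) (hsdotC_eq0 g12).
rewrite n1 n2 m1 m2.
by rewrite !(mulr0, mul0r, subr0, addr0, oppr0, add0r, subrr, opprK, eqxx).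
Qed.

Lemma domino_neq0 m n (x0 x1 x2 : 'cV[C]_m) (y0 y1 y2 : 'cV[C]_n) :
  x0 != 0 -> equigram x0 x1 x2 -> y0 != 0 -> equigram y0 y1 y2 ->
  {in domino x0 x1 x2 y0 y1 y2, forall s, tens s != 0}.
Proof.
move=> x0n Ex y0n Ey s; rewrite tens_eq0 negb_or /domino !inE.
have [? ? ? ? ?] := equigram_normD x0n Ex; have [? ? ? ? ?] := equigram_normD y0n Ey.
by move=> /or4P[|||/or4P[|||/orP[]]] /eqP -> /=; apply/andP.
Qed.

(* The p's and q's are the current images of the x's and y's, which need not stay
   normalized; p0 = 0 is possible. *)
Lemma domino_rigid m n (p0 p1 p2 : 'cV[C]_m) (q0 q1 q2 : 'cV[C]_n) :
  q0 != 0 -> equigram q0 q1 q2 -> pairwise (@orth m n) (domino p0 p1 p2 q0 q1 q2) ->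
  equigram p0 p1 p2.
Proof.
move=> q0n [m1 m2 g01 g02 g12]; move: q0n; rewrite -hsdot_eq0 => c0.
rewrite /= /orth /= !hsdot_expand.
rewrite g01 g02 g12 (hsdotC_eq0 g01) (hsdotC_eq0 g02) (hsdotC_eq0 g12) m1 m2.
rewrite !(mulr0, mul0r, subr0, addr0, oppr0, add0r, subrr, opprK, eqxx) !mulf_eq0.
rewrite oppr_eq0 !(negPf c0) ?orbF ?andbT /=.
(* Bob's Gram matrix being scalar, only these pairs carry information: a [p0] state against a [p2]
   state, [p0] against [p1 + p2] through [q0], [p2] against [p1 + p0] through [q2], and the two
   pairs with the same vector on Bob's side, which compare norms. *)
case/and5P=> /and4P[/eqP h02 _ h01 _] _ /andP[h21 _] _ /andP[h12 h10].
move: h01; rewrite h02 addr0 => /eqP h01.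
move: h21; rewrite (hsdotC_eq0 h02) addr0 => /eqP h21.
move: h12 h10; rewrite h21 (hsdotC_eq0 h21) h01 (hsdotC_eq0 h01).
rewrite !addr0 oppr0 !add0r !subr_eq0 => /eqP h12 /eqP h10.
by split; rewrite ?(hsdotC_eq0 h21) // -h12.
Qed.

(** Swapping the parties and exchanging [q0] with [q2] maps the domino states to themselves, but
    permutes the list; the same argument is therefore run on the other pairs. *)
Lemma domino_rigid_dual m n (p0 p1 p2 : 'cV[C]_m) (q0 q1 q2 : 'cV[C]_n) :
  p0 != 0 -> equigram p0 p1 p2 -> pairwise (@orth m n) (domino p0 p1 p2 q0 q1 q2) ->
  equigram q0 q1 q2.
Proof.
move=> p0n [n1 n2 h01 h02 h12]; move: p0n; rewrite -hsdot_eq0 => c0.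
rewrite /= /orth /= !hsdot_expand.
rewrite h01 h02 h12 (hsdotC_eq0 h01) (hsdotC_eq0 h02) (hsdotC_eq0 h12) n1 n2.
rewrite !(mulr0, mul0r, subr0, addr0, oppr0, add0r, subrr, opprK, eqxx) !mulf_eq0.
rewrite ?oppr_eq0 !(negPf c0) ?orbF ?andbT /=.
case/and5P=> /and3P[/eqP n01 /eqP g12 _] _ /and3P[/eqP n12 /eqP g10 _] _.
case/and3P=> /andP[/eqP g02 _] _ _.
move: g12 g10; rewrite g02 (hsdotC_eq0 g02) !addr0 => g12 g10.
move: n01 n12; rewrite g10 g12 (hsdotC_eq0 g10) (hsdotC_eq0 g12) !addr0 oppr0 !add0r.
by move=> /subr0_eq n01 /subr0_eq n12; split; rewrite ?(hsdotC_eq0 g10) // -n12.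
Qed.

(** Induction on the protocol. The invariant is that the accumulated operators [A] and [B] act on
    the two triples as nonzero multiples of isometries; it holds at the root with both equal to 1,
    and rigidity carries it to the measuring party's next operator. *)
Lemma domino_indistinguishable m n (x0 x1 x2 : 'cV[C]_m) (y0 y1 y2 : 'cV[C]_n)
    (S : {fset 'cV[C]_(m * n)}) :
  x0 != 0 -> equigram x0 x1 x2 -> y0 != 0 -> equigram y0 y1 y2 ->
  {in domino x0 x1 x2 y0 y1 y2, forall s, tens s \in S} ->
  ~ locally_distinguishable S.
Proof.
move=> x0n Ex y0n Ey subS [P idP].
have neq : pairwise (fun s t => tens s != tens t) (domino x0 x1 x2 y0 y1 y2).
  apply: (@sub_in_pairwise _ [pred s | tens s != 0]) (domino_orth Ex Ey) => [s t|].
    move=> s0 _ /eqP st; apply: hsdot_neq; last by rewrite hsdot_tensE.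
    by rewrite hsdot_eq0; exact: s0.
  by apply/allP => s; exact: domino_neq0.
pose img (A : 'M[C]_m) (B : 'M[C]_n) (s : 'cV_m * 'cV_n) := (A *m s.1, B *m s.2).
have img_domino A B : map (img A B) (domino x0 x1 x2 y0 y1 y2) =
    domino (A *m x0) (A *m x1) (A *m x2) (B *m y0) (B *m y1) (B *m y2).
  by rewrite /= /img /= !mulmxDr !mulmxN.
have orth_img Q A B :
    {in domino x0 x1 x2 y0 y1 y2, forall s, identifies Q (tens s) (tens (img A B s))} ->
    pairwise (@orth m n) (domino (A *m x0) (A *m x1) (A *m x2) (B *m y0) (B *m y1) (B *m y2)).
  move=> idQ; rewrite -img_domino pairwise_map.
  apply: (@sub_in_pairwise _ [in domino x0 x1 x2 y0 y1 y2]) neq; last exact/allP.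
  move=> s t sd td st; apply/eqP; rewrite -hsdot_tensE.
  by apply: identifies_orthogonal st _ _; apply: idQ.
have : {in domino x0 x1 x2 y0 y1 y2, forall s,
    identifies P (tens s) (tens (img 1%:M 1%:M s))}.
  move=> [a b] sd; rewrite /img !mul1mx /=; apply: idP; exact: subS.
have : equigram (1%:M *m x0) (1%:M *m x1) (1%:M *m x2) by rewrite !mul1mx.
have : equigram (1%:M *m y0) (1%:M *m y1) (1%:M *m y2) by rewrite !mul1mx.
have : 1%:M *m x0 != 0 by rewrite mul1mx.
have : 1%:M *m y0 != 0 by rewrite mul1mx.
move: (1%:M : 'M[C]_m) (1%:M : 'M[C]_n) => A B; clear idP.
elim: P A B => [phi|M next IH|N next IH] A B By0 Ax0 EBy EAx idP.
(* Under the invariant the first two states are still nonzero at the leaf, so its single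
   announcement would have to equal both. *)
- have [_ _ _ Dy0 By0'] := equigram_normD By0 EBy.
  have /= /andP[/andP[+ _] _] := neq.
  rewrite -(idP (x0, y1 + y0)) -?(idP (x0, y1 - y0)) ?eqxx ?inE ?eqxx ?orbT //.
    by rewrite tens_eq0 negb_or /= mulmxBr Ax0.
  by rewrite tens_eq0 negb_or /= mulmxDr Ax0.
- have idn a : {in domino x0 x1 x2 y0 y1 y2, forall s,
      identifies (next a) (tens s) (tens (img (kraus M a *m A) B s))}.
    move=> s sd; have := idP s sd a.
    by rewrite /tens tensmx_prod mul1mx mulmxA.
  have En a : equigram (kraus M a *m A *m x0) (kraus M a *m A *m x1) (kraus M a *m A *m x2).
    exact: domino_rigid By0 EBy (orth_img _ _ _ (idn a)).
  (* Follow an outcome that does not annihilate the image of [x0]: such an outcome exists because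
     the squared norms add up to that of [A *m x0]. *)
  have /existsP[a Ka] : [exists a, kraus M a *m A *m x0 != 0].
    apply: contraNT Ax0 => /existsPn Kx0; rewrite -hsdot_eq0 (hsdot_kraus M) big1 // => a _.
    by apply/eqP; rewrite hsdot_eq0 mulmxA -[_ == _]negbK Kx0.
  exact: IH By0 Ka EBy (En a) (idn a).
- have idn b : {in domino x0 x1 x2 y0 y1 y2, forall s,
      identifies (next b) (tens s) (tens (img A (kraus N b *m B) s))}.
    move=> s sd; have := idP s sd b.
    by rewrite /tens tensmx_prod mul1mx mulmxA.
  have En b : equigram (kraus N b *m B *m y0) (kraus N b *m B *m y1) (kraus N b *m B *m y2).
    exact: domino_rigid_dual Ax0 EAx (orth_img _ _ _ (idn b)).
  have /existsP[b Kb] : [exists b, kraus N b *m B *m y0 != 0].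
    apply: contraNT By0 => /existsPn Ky0; rewrite -hsdot_eq0 (hsdot_kraus N) big1 // => b _.
    by apply/eqP; rewrite hsdot_eq0 mulmxA -[_ == _]negbK Ky0.
  exact: IH Kb Ax0 (En b) EAx (idn b).
Qed.

(** * Distinguishing product states by successive projective measurements *)

(** Gram-Schmidt: [P] is the orthogonal projector onto the span of [L]. Each new [x] contributes the
    rank-one projector on its component [w] orthogonal to the previous range. *)
Lemma ortho_projector d (L : seq 'cV[C]_d) :
  exists P : 'M[C]_d, [/\ P^t* = P, P *m P = P, {in L, forall x, P *m x = x} &
    forall y, {in L, forall x, hsdot x y = 0} -> P *m y = 0].
Proof.
elim: L => [|x L [P [Padj PP PL PLo]]].
  by exists 0; split => [||x|y _]; rewrite ?trmx0 ?map_mx0 ?mul0mx ?in_nil.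
pose w := x - P *m x; pose h := hsdot w w.
have Pw : P *m w = 0 by rewrite mulmxBr mulmxA PP subrr.
have wP : w^t* *m P = 0.
  by rewrite -{1}Padj -adjmxM Pw trmx0 map_mx0.
have ww : w^t* *m w = h%:M.
  by rewrite [LHS]mx11_scalar /h /hsdot /mxtrace big_ord1.
(* If [x] already lies in the range, then [w = 0] and [h^-1 = 0], so the added term vanishes and
   needs no separate case. *)
have hV0 : h^-1 *: (h *: w) = w.
  have [/eqP h0|h0] := eqVneq h 0; last by rewrite scalerA mulVf // scale1r.
  by move: h0; rewrite hsdot_eq0 => /eqP ->; rewrite !scaler0.
exists (P + h^-1 *: (w *m w^t*)); split.
- rewrite linearD map_mxD Padj linearZ map_mxZ /= adjmxM trmxCK fmorphV.
  by rewrite /= {1}/h -hsdotC.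
- rewrite mulmxDl !mulmxDr PP -!scalemxAr -!scalemxAl mulmxA Pw mul0mx -!mulmxA wP.
  rewrite mulmx0 !scaler0 addr0 add0r (mulmxA (w^t*)) ww mul_scalar_mx -scalemxAr.
  congr (_ + _); have [->|h0] := eqVneq h 0; first by rewrite invr0 !scale0r.
  by congr (_ *: _); rewrite scalerA mulVf // scale1r.
- move=> y; rewrite inE mulmxDl -scalemxAl -mulmxA => /orP[/eqP->|yL].
    have -> : w^t* *m x = h%:M.
      by rewrite -{1}(subrK (P *m x) x) mulmxDr (mulmxA _ P) wP mul0mx addr0 ww.
    by rewrite mul_mx_scalar hV0 addrC subrK.
  by rewrite PL // -{2}(PL _ yL) (mulmxA _ P) wP mul0mx mulmx0 scaler0 addr0.
- move=> y yo; have Py : P *m y = 0 by apply: PLo => z zL; rewrite yo ?inE ?zL ?orbT.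
  have wy : w^t* *m y = 0.
    rewrite [LHS]mx11_scalar (_ : _ 0 0 = hsdot w y); last by rewrite /hsdot /mxtrace big_ord1.
    by rewrite hsdotDl hsdotNl hsdot_adj Padj Py hsdot0r yo ?mem_head // subr0 raddf0.
  by rewrite mulmxDl Py -scalemxAl -mulmxA wy mulmx0 scaler0 addr0.
Qed.

Lemma dichotomy_complete d (P : 'M[C]_d) : P^t* = P -> P *m P = P ->
  \sum_(i < 2) (if i == 0 then P else 1%:M - P)^t* *m (if i == 0 then P else 1%:M - P) = 1%:M.
Proof.
move=> Padj PP; rewrite !big_ord_recl big_ord0 addr0 /= [(1%:M - P)^T]linearB map_mxB.
rewrite /= Padj PP trmx1 map_mx1 mulmxBl mul1mx mulmxBr mulmx1 PP subrr subr0.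
by rewrite addrC subrK.
Qed.

(** Stated for lists of factor pairs, so that a splitting condition can speak of one party's factor
    alone. *)
Definition distinguishable m n (T : seq ('cV[C]_m * 'cV[C]_n)) :=
  exists P : protocol C m n, {in T, forall s, identifies P (tens s) (tens s)}.

(* The splitting measurement disturbs no state: each of its projectors fixes or
   annihilates every state. *)
Lemma distinguishable_splitA m n (T1 T2 : seq ('cV[C]_m * 'cV[C]_n)) :
  {in T1 & T2, forall s t, hsdot s.1 t.1 = 0} ->
  distinguishable T1 -> distinguishable T2 -> distinguishable (T1 ++ T2).
Proof.
move=> T12 [P1 id1] [P2 id2].
have [Q [Qadj QQ QT1 QT2]] := ortho_projector (map fst T1).
pose M := Measurement (dichotomy_complete Qadj QQ).
exists (Alice (M := M) (fun i => if i == 0 then P1 else P2)) => s.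
rewrite mem_cat => sT i /=; rewrite /tens tensmx_prod mul1mx.
have [sT1|sNT1] := boolP (s \in T1).
  have Qs : Q *m s.1 = s.1 by rewrite QT1 ?map_f.
  case: ifP => _; first by rewrite Qs; exact: id1.
  by rewrite mulmxBl mul1mx Qs subrr tens0mx; exact: identifies0.
have sT2 : s \in T2 by rewrite (negPf sNT1) in sT.
have Qs : Q *m s.1 = 0 by apply: QT2 => _ /mapP[t tT1 ->]; exact: T12.
case: ifP => _; first by rewrite Qs tens0mx; exact: identifies0.
by rewrite mulmxBl mul1mx Qs subr0; exact: id2.
Qed.

Lemma distinguishable_splitB m n (T1 T2 : seq ('cV[C]_m * 'cV[C]_n)) :
  {in T1 & T2, forall s t, hsdot s.2 t.2 = 0} ->
  distinguishable T1 -> distinguishable T2 -> distinguishable (T1 ++ T2).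
Proof.
move=> T12 [P1 id1] [P2 id2].
have [Q [Qadj QQ QT1 QT2]] := ortho_projector (map snd T1).
pose N := Measurement (dichotomy_complete Qadj QQ).
exists (Bob (N := N) (fun i => if i == 0 then P1 else P2)) => s.
rewrite mem_cat => sT i /=; rewrite /tens tensmx_prod mul1mx.
have [sT1|sNT1] := boolP (s \in T1).
  have Qs : Q *m s.2 = s.2 by rewrite QT1 ?map_f.
  case: ifP => _; first by rewrite Qs; exact: id1.
  by rewrite mulmxBl mul1mx Qs subrr tensmx0; exact: identifies0.
have sT2 : s \in T2 by rewrite (negPf sNT1) in sT.
have Qs : Q *m s.2 = 0 by apply: QT2 => _ /mapP[t tT1 ->]; exact: T12.
case: ifP => _; first by rewrite Qs tensmx0; exact: identifies0.
by rewrite mulmxBl mul1mx Qs subr0; exact: id2.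
Qed.

Lemma distinguishable_nil m n : @distinguishable m n [::].
Proof. by exists (Announce 0). Qed.

Lemma distinguishable1 m n (s : 'cV[C]_m * 'cV[C]_n) : distinguishable [:: s].
Proof. by exists (Announce (tens s)) => t; rewrite inE => /eqP ->. Qed.

Lemma distinguishable_pairwiseA m n (T : seq ('cV[C]_m * 'cV[C]_n)) :
  pairwise (fun s t => hsdot s.1 t.1 == 0) T -> distinguishable T.
Proof.
elim: T => [_|s T IH /= /andP[/allP sT /IH DT]]; first exact: distinguishable_nil.
apply: (distinguishable_splitA (T1 := [:: s])) (distinguishable1 s) DT.
by move=> _ t /[!inE] /eqP -> /sT /eqP.
Qed.

Lemma distinguishable_pairwiseB m n (T : seq ('cV[C]_m * 'cV[C]_n)) :
  pairwise (fun s t => hsdot s.2 t.2 == 0) T -> distinguishable T.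
Proof.
elim: T => [_|s T IH /= /andP[/allP sT /IH DT]]; first exact: distinguishable_nil.
apply: (distinguishable_splitB (T1 := [:: s])) (distinguishable1 s) DT.
by move=> _ t /[!inE] /eqP -> /sT /eqP.
Qed.

(** * Partial traces of product states and irredundancy *)

(* The reduced operator of x in C^k (x) C^d is X *m X^t* with X := unvec x. *)
Definition unvec k d (x : 'cV[C]_(k * d)) : 'M[C]_(k, d) :=
  \matrix_(i, j) x (mxtens_index (i, j)) 0.

Lemma unvec_eq0 k d (x : 'cV[C]_(k * d)) : (unvec x == 0) = (x == 0).
Proof.
apply/eqP/eqP => [x0|->]; last by apply/matrixP => i j; rewrite !mxE.
apply/matrixP => i j; rewrite (ord1 j); case: (mxtens_indexP i) => a b.
by move/matrixP: x0 => /(_ a b); rewrite !mxE.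
Qed.

Lemma unitary_mul_eq0 k m (U : 'M[C]_(k, m)) (x : 'cV[C]_m) :
  k = m -> U \is unitarymx -> (U *m x == 0) = (x == 0).
Proof.
move=> km; case: m / km in U x *; move=> /unitarymx_unit Uu.
apply/eqP/eqP => [Ux0|->]; last exact: mulmx0.
by rewrite -(mulKmx Uu x) Ux0 mulmx0.
Qed.

Lemma reduced_tens m n ka da kb db (U : 'M[C]_(ka * da, m)) (V : 'M[C]_(kb * db, n))
    (s : 'cV[C]_m * 'cV[C]_n) :
  reduced U V (tens s) =
    (unvec (U *m s.1) *m (unvec (U *m s.1))^t*) *t (unvec (V *m s.2) *m (unvec (V *m s.2))^t*).
Proof.
rewrite /reduced /tens tensmx_prod; apply/matrixP => i j.
case: (mxtens_indexP i) => i1 i2; case: (mxtens_indexP j) => j1 j2.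
rewrite tensmxE !mxE !mxtens_indexK /= big_distrlr /=.
apply: eq_bigr => x _; apply: eq_bigr => y _.
rewrite !mxE big_ord1 !mxE !mxtens_indexK /= !ord1 rmorphM /=.
by rewrite mulrACA.
Qed.

(** Cyclicity of the trace. Orthogonality of two reduced operators thus becomes [X^t* *m Y = 0],
    that is, orthogonality of the ranges of [X] and [Y]. *)
Lemma hsdot_gram k d (X Y : 'M[C]_(k, d)) :
  hsdot (X *m X^t*) (Y *m Y^t*) = hsdot (X^t* *m Y) (X^t* *m Y).
Proof.
rewrite /hsdot !adjmxM !trmxCK mulmxA [in LHS]mxtrace_mulC.
by rewrite !mulmxA.
Qed.

(** One nonzero column taken from each [X i] gives [p] orthogonal vectors of C^k. Their Gram matrix
    is diagonal and invertible, hence of rank [p]. *)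
Lemma orthogonal_ranges_bound p k d (X : 'I_p -> 'M[C]_(k, d)) :
  (forall i, X i != 0) -> (forall i j, i != j -> (X i)^t* *m X j = 0) -> (p <= k)%N.
Proof.
move=> X0 XX.
have /fin_all_exists[c Xc] i : exists c, col c (X i) != 0.
  apply/existsP; apply: contraNT (X0 i) => /existsPn Xi0.
  apply/eqP/matrixP => a b; have := Xi0 b; rewrite negbK => /eqP/matrixP/(_ a 0).
  by rewrite !mxE.
pose Y := \matrix_(a < k, j < p) X j a (c j).
have YY : Y^t* *m Y = diag_mx (\row_i hsdot (col (c i) (X i)) (col (c i) (X i))).
  apply/matrixP => i j; rewrite !mxE.
  have -> : \sum_a Y^t* i a * Y a j = hsdot (col (c i) (X i)) (col (c j) (X j)).
    by rewrite hsdotE big_ord1; apply: eq_bigr => a _; rewrite !mxE.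
  case: eqVneq => [->|ij]; first by rewrite mulr1n.
  rewrite mulr0n hsdotE big_ord1; have /matrixP/(_ (c i) (c j)) := XX _ _ ij.
  by rewrite !mxE => XXij; rewrite -[RHS]XXij; apply: eq_bigr => a _; rewrite !mxE.
have rkp : \rank (Y^t* *m Y) = p.
  apply: mxrank_unit; rewrite unitmxE YY det_diag unitfE prodf_seq_neq0.
  by apply/allP => i _ /=; rewrite mxE hsdot_eq0.
by rewrite -rkp (leq_trans (mxrankM_maxr _ _)) ?rank_leq_row.
Qed.

Lemma kept_dim_boundA m n ka da kb db (U : 'M[C]_(ka * da, m)) (V : 'M[C]_(kb * db, n))
    p (f : 'I_p -> 'cV[C]_m) (b : 'cV[C]_n) :
  (ka * da = m)%N -> U \is unitarymx -> (kb * db = n)%N -> V \is unitarymx ->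
  b != 0 -> (forall i, f i != 0) ->
  (forall i j, i != j -> hsdot (reduced U V (tens (f i, b))) (reduced U V (tens (f j, b))) = 0) ->
  (p <= ka)%N.
Proof.
move=> em Uu en Vu b0 f0 red; apply: (@orthogonal_ranges_bound _ _ _ (fun i => unvec (U *m f i))).
  by move=> i; rewrite unvec_eq0 unitary_mul_eq0.
move=> i j /red /eqP; rewrite !reduced_tens hsdot_tens mulf_eq0 /= !hsdot_gram !hsdot_eq0.
(* The other alternative would make the reduction of Bob's common vector [b] orthogonal to itself,
   forcing [b = 0]. *)
case/orP => [/eqP //|]; move/eqP => Y0.
have: unvec (V *m b) == 0 by rewrite -hsdot_eq0 /hsdot Y0 mxtrace0.
by rewrite unvec_eq0 unitary_mul_eq0 // (negPf b0).
Qed.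

Lemma kept_dim_boundB m n ka da kb db (U : 'M[C]_(ka * da, m)) (V : 'M[C]_(kb * db, n))
    p (a : 'cV[C]_m) (g : 'I_p -> 'cV[C]_n) :
  (ka * da = m)%N -> U \is unitarymx -> (kb * db = n)%N -> V \is unitarymx ->
  a != 0 -> (forall i, g i != 0) ->
  (forall i j, i != j -> hsdot (reduced U V (tens (a, g i))) (reduced U V (tens (a, g j))) = 0) ->
  (p <= kb)%N.
Proof.
move=> em Uu en Vu a0 g0 red; apply: (@orthogonal_ranges_bound _ _ _ (fun i => unvec (V *m g i))).
  by move=> i; rewrite unvec_eq0 unitary_mul_eq0.
move=> i j /red /eqP; rewrite !reduced_tens hsdot_tens mulf_eq0 /= !hsdot_gram !hsdot_eq0.
case/orP => [|/eqP //]; move/eqP => X0.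
have: unvec (U *m a) == 0 by rewrite -hsdot_eq0 /hsdot X0 mxtrace0.
by rewrite unvec_eq0 unitary_mul_eq0 // (negPf a0).
Qed.

(** Discarding a factor of dimension at least 2 leaves at most half of that party's dimension, which
    is less than the number of states differing only on that side. *)
Lemma irredundant m n (S : {fset 'cV[C]_(m * n)}) p (f : 'I_p -> 'cV[C]_m)
    (b : 'cV[C]_n) q (a : 'cV[C]_m) (g : 'I_q -> 'cV[C]_n) :
  (m < p.*2)%N -> (n < q.*2)%N -> a != 0 -> b != 0 ->
  (forall i, f i != 0) -> (forall i, g i != 0) ->
  (forall i j, i != j -> hsdot (f i) (f j) = 0) ->
  (forall i j, i != j -> hsdot (g i) (g j) = 0) ->
  (forall i, tens (f i, b) \in S) -> (forall i, tens (a, g i) \in S) ->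
  ~ locally_redundant S.
Proof.
move=> mp nq a0 b0 f0 g0 ff gg fS gS [ka [da [kb [db [U [V [[em Uu] [en Vu] discard red]]]]]]].
have half k d l r : (k * d = l)%N -> (1 < d)%N -> (l < r.*2)%N -> (r <= k)%N -> False.
  move=> <- d1 kdr rk; move: kdr; rewrite ltnNge -muln2 => /negP; apply.
  exact: leq_mul.
case: discard => [d1|d1].
  apply: (half _ _ _ _ em d1 mp); apply: (kept_dim_boundA em Uu en Vu b0 f0) => i j ij.
  apply: red => //; apply: hsdot_neq; rewrite hsdot_tensE; last by rewrite ff // mul0r.
  by rewrite mulf_neq0 ?hsdot_eq0 /=.
apply: (half _ _ _ _ en d1 nq); apply: (kept_dim_boundB em Uu en Vu a0 g0) => i j ij.
apply: red => //; apply: hsdot_neq; rewrite hsdot_tensE; last by rewrite gg // mulr0.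
by rewrite mulf_neq0 ?hsdot_eq0 /=.
Qed.

End LocalDiscrimination.

Section HiddenSet.
Variable C : numClosedFieldType.

(** * The flagged domino states and Alice's test *)

Definition ket d (k : nat) : 'cV[C]_d := \col_i ((i : nat) == k)%:R.

Lemma hsdot_ket d j k : hsdot (ket d j) (ket d k) = ((j < d)%N && (j == k))%:R.
Proof.
rewrite hsdotE big_ord1; have [jd|dj] /= := ltnP j d.
  rewrite (bigD1 (Ordinal jd)) //= big1 => [|i /negPf ij].
    by rewrite !mxE /= eqxx conjC1 mul1r addr0.
  by rewrite !mxE [_ == j]ij conjC0 mul0r.
by rewrite big1 // => i _; rewrite !mxE (ltn_eqF (leq_trans (ltn_ord i) dj)) conjC0 mul0r.
Qed.

Lemma ket_neq0 d k : (k < d)%N -> ket d k != 0.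
Proof. by move=> kd; rewrite -hsdot_eq0 hsdot_ket kd eqxx oner_eq0. Qed.

Definition low_proj d : 'M[C]_d := diag_mx (\row_i (i < 3)%N%:R).

Lemma low_proj_adj d : (low_proj d)^t* = low_proj d.
Proof. by rewrite tr_diag_mx; apply/matrixP => i j; rewrite !mxE -mulrnA conjC_nat. Qed.

Lemma low_proj_idem d : low_proj d *m low_proj d = low_proj d.
Proof.
rewrite mulmx_diag; congr diag_mx; apply/rowP => i; rewrite !mxE.
by rewrite -natrM mulnb andbb.
Qed.

Lemma low_proj_ket d k : low_proj d *m ket d k = if (k < 3)%N then ket d k else 0.
Proof.
apply/colP => i; rewrite mul_diag_mx !mxE; case: (ltnP k 3) => k3; rewrite !mxE.
  by case: eqP => [->|]; rewrite ?k3 ?mulr1 ?mulr0.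
by case: eqP => [->|]; rewrite ?mulr0 // ltnNge k3 mul0r.
Qed.

Definition low_measurement d : measurement C d :=
  Measurement (dichotomy_complete (low_proj_adj d) (low_proj_idem d)).

Lemma low_measurement_ket d (a : 'I_2) k :
  kraus (low_measurement d) a *m ket d k = if (k < 3)%N == (a == 0) then ket d k else 0.
Proof.
rewrite /=; case: (a == 0); first by rewrite low_proj_ket eqb_id.
by rewrite mulmxBl mul1mx low_proj_ket eqbF_neg; case: ifP => _; rewrite ?subrr ?subr0.
Qed.

(** The kets 3, 4, 5 copy 0, 1, 2. The relative signs make [ket m 2 + ket m 5] orthogonal to
    [ket m 2 - ket m 5], and similarly for 0 and 3, so Alice can separate the first four states from
    the last four. *)
Definition flagged_domino m n : seq ('cV[C]_m * 'cV[C]_n) :=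
  [:: (ket m 0 + ket m 3, ket n 1 + ket n 0); (ket m 0 + ket m 3, ket n 1 - ket n 0);
      (ket m 2 + ket m 5, ket n 1 + ket n 2); (ket m 2 + ket m 5, ket n 1 - ket n 2);
      (ket m 1 + ket m 4 + (ket m 2 - ket m 5), ket n 0);
      (ket m 1 + ket m 4 - (ket m 2 - ket m 5), ket n 0);
      (ket m 1 + ket m 4 + (ket m 0 - ket m 3), ket n 2);
      (ket m 1 + ket m 4 - (ket m 0 - ket m 3), ket n 2)].

(** The column skips [k = 3], already in the row: a repeated entry would not be orthogonal to
    itself. *)
Definition hidden_set m n : seq ('cV[C]_m * 'cV[C]_n) :=
  [seq (ket m k, ket n 3) | k <- iota 0 m] ++
  ([seq (ket m 6, ket n k) | k <- [seq k <- iota 0 n | k != 3]] ++ flagged_domino m n).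

(* For A = 1 or a Kraus operator of [low_measurement], g says which kets A fixes,
   the other ones being annihilated.  The two equations say that erasing the flag
   keeps equally many components of each flagged vector. *)
Lemma hidden_orth m n (A : 'M[C]_m) (g : nat -> bool) : (6 < m)%N -> (6 < n)%N ->
  (forall j k, hsdot (A *m ket m j) (A *m ket m k) = [&& (j < m)%N, j == k & g j]%:R) ->
  (g 0 + g 3 = g 1 + g 4)%N -> (g 2 + g 5 = g 1 + g 4)%N ->
  pairwise (@orth C m n) [seq (A *m s.1, s.2) | s <- hidden_set m n].
Proof.
move=> m6 n6 gramA g03 g25.
have ltn_m k : (k < 7)%N -> (k < m)%N by move/leq_trans; apply.
have ltn_n k : (k < 7)%N -> (k < n)%N by move/leq_trans; apply.
rewrite /hidden_set !map_cat !pairwise_cat; apply/and3P; split; last (apply/and3P; split).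
- apply/allrelP => s t /mapP[_ /mapP[j _ ->] ->].
  rewrite -map_cat => /mapP[s' + ->]; rewrite /orth mem_cat => /orP[/mapP[k + ->]|].
    by rewrite mem_filter => /andP[k3 _]; rewrite hsdot_ket [3 == k]eq_sym (negPf k3) andbF mulr0.
  rewrite /flagged_domino !inE.
  by move=> /or4P[|||/or4P[|||/orP[]]] /eqP -> /=;
    rewrite ?hsdot_expand !hsdot_ket !andbF ?(addr0, subr0, oppr0) mulr0.
- rewrite -map_comp pairwise_map; have := iota_uniq 0 m; rewrite uniq_pairwise; apply: sub_pairwise.
  by move=> j k /= /negPf jk; rewrite /orth /= gramA jk andbF mul0r.
- apply/allrelP => s t /mapP[_ /mapP[j _ ->] ->] /mapP[s' + ->].
  rewrite /orth /flagged_domino !inE.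
  by move=> /or4P[|||/or4P[|||/orP[]]] /eqP -> /=;
    rewrite ?(mulmxDr, mulmxN) ?hsdot_expand !gramA /= !andbF ?(addr0, subr0, oppr0) mul0r.
- rewrite -map_comp pairwise_map; apply: pairwise_filter.
  have := iota_uniq 0 n; rewrite uniq_pairwise; apply: sub_pairwise.
  by move=> j k /= /negPf jk; rewrite /orth /= hsdot_ket jk andbF mulr0.
- rewrite /= /orth /= ?(mulmxDr, mulmxN) !hsdot_expand !gramA !hsdot_ket !ltn_m // !ltn_n // /=.
  rewrite !(add0r, addr0, oppr0, subr0, mul0r, mulr0, mulr1, subrr, eqxx) /=.
  (* What remains are the two pairs sharing Bob's vector. Alice's vectors there are a sum and a
     difference of the same orthogonal parts, so the squared norms of those parts have to agree. *)
  by rewrite !opprK -!opprD -!natrD g25 g03 subrr eqxx.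
Qed.

Lemma hidden_tens_neq0 m n : (6 < m)%N -> (6 < n)%N ->
  {in hidden_set m n, forall s, tens s != 0}.
Proof.
move=> m6 n6 s.
have ltn_m k : (k < 7)%N -> (k < m)%N by move/leq_trans; apply.
have ltn_n k : (k < 7)%N -> (k < n)%N by move/leq_trans; apply.
rewrite tens_eq0 negb_or -!hsdot_eq0 !mem_cat => /or3P[/mapP[k + ->]|/mapP[k + ->]|].
- by rewrite mem_iota /= !hsdot_ket => ->; rewrite ltn_n // !eqxx oner_eq0.
- by rewrite mem_filter mem_iota /= !hsdot_ket ltn_m // => /andP[_ ->]; rewrite !eqxx oner_eq0.
rewrite /flagged_domino !inE.
by move=> /or4P[|||/or4P[|||/orP[]]] /eqP -> /=;
  rewrite ?hsdot_expand !hsdot_ket !ltn_m // !ltn_n //=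
    ?(add0r, addr0, oppr0, subr0, opprK) -?opprD ?opprK;
  apply/andP; split; rewrite gt_eqF // ?addr_gt0 ?ltr01.
Qed.

(** The protocol: Bob tests for ket 3, isolating the row; Alice tests for ket 6, isolating the
    column; Alice then tests for [ket m 0 + ket m 3] and for [ket m 2 + ket m 5], after either of
    which Bob finishes. Otherwise Bob separates ket 0 from ket 2 and Alice reads the sign. *)
Lemma hidden_distinguishable m n : (6 < m)%N -> (6 < n)%N ->
  distinguishable (hidden_set m n).
Proof.
move=> m6 n6; have ltn_m k : (k < 7)%N -> (k < m)%N by move/leq_trans; apply.
have ltn_n k : (k < 7)%N -> (k < n)%N by move/leq_trans; apply.
apply: distinguishable_splitB.
- move=> _ t /mapP[j _ ->]; rewrite mem_cat => /orP[/mapP[k + ->]|].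
    by rewrite mem_filter => /andP[k3 _]; rewrite hsdot_ket [3 == k]eq_sym (negPf k3) andbF.
  rewrite /flagged_domino !inE.
  by move=> /or4P[|||/or4P[|||/orP[]]] /eqP -> /=;
    rewrite ?hsdot_expand !hsdot_ket !andbF ?(addr0, subr0, oppr0).
- apply: distinguishable_pairwiseA; rewrite pairwise_map.
  have := iota_uniq 0 m; rewrite uniq_pairwise; apply: sub_pairwise.
  by move=> j k /= /negPf jk; rewrite hsdot_ket jk andbF.
apply: distinguishable_splitA.
- move=> _ t /mapP[j _ ->]; rewrite /flagged_domino !inE.
  by move=> /or4P[|||/or4P[|||/orP[]]] /eqP -> /=;
    rewrite ?hsdot_expand !hsdot_ket !andbF ?(addr0, subr0, oppr0).
- apply: distinguishable_pairwiseB; rewrite pairwise_map; apply: pairwise_filter.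
  have := iota_uniq 0 n; rewrite uniq_pairwise; apply: sub_pairwise.
  by move=> j k /= /negPf jk; rewrite hsdot_ket jk andbF.
apply: (@distinguishable_splitA _ _ _ [:: _; _] [:: _; _; _; _; _; _]).
- move=> s t; rewrite !inE => /orP[] /eqP -> /or4P[|||/or3P[]] /eqP ->;
    by rewrite /= ?hsdot_expand !hsdot_ket !ltn_m //= ?(add0r, addr0, oppr0, subr0, subrr).
- apply: distinguishable_pairwiseB.
  by rewrite /= !hsdot_expand !hsdot_ket !ltn_n //= ?(add0r, addr0, oppr0, subr0, subrr) eqxx.
apply: (@distinguishable_splitA _ _ _ [:: _; _] [:: _; _; _; _]).
- move=> s t; rewrite !inE => /orP[] /eqP -> /or4P[] /eqP ->;
    by rewrite /= ?hsdot_expand !hsdot_ket !ltn_m //= ?(add0r, addr0, oppr0, subr0, subrr).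
- apply: distinguishable_pairwiseB.
  by rewrite /= !hsdot_expand !hsdot_ket !ltn_n //= ?(add0r, addr0, oppr0, subr0, subrr) eqxx.
apply: (@distinguishable_splitB _ _ _ [:: _; _] [:: _; _]).
- move=> s t; rewrite !inE => /orP[] /eqP -> /orP[] /eqP ->;
    by rewrite /= ?hsdot_expand !hsdot_ket !ltn_n //= ?(add0r, addr0, oppr0, subr0, subrr).
- apply: distinguishable_pairwiseA.
  rewrite /= !hsdot_expand !hsdot_ket !ltn_m //= ?(add0r, addr0, oppr0, subr0, subrr).
  by rewrite opprK -opprD subrr eqxx.
- apply: distinguishable_pairwiseA.
  rewrite /= !hsdot_expand !hsdot_ket !ltn_m //= ?(add0r, addr0, oppr0, subr0, subrr).
  by rewrite opprK -opprD subrr eqxx.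
Qed.

(** Distinct states sit at distinct positions of the list, in either order; this turns orthogonality
    along a list into the form required for sets and for OPLMs. *)
Lemma pairwise_orth_image m n k l (F : 'cV[C]_m * 'cV[C]_n -> 'cV[C]_k * 'cV[C]_l) T :
  pairwise (@orth C k l) (map F T) ->
  {in T &, forall s t, tens s != tens t -> hsdot (tens (F s)) (tens (F t)) = 0}.
Proof.
rewrite pairwise_map => /(pairwiseP (0, 0)) FT s t /(nthP (0, 0))[i iT <-] /(nthP (0, 0))[j jT <-].
move=> neq; rewrite hsdot_tensE; apply/eqP; have [ij|ji|eij] := ltngtP i j; first exact: FT.
  by rewrite -/(orth _ _) orth_sym; apply: FT.
by rewrite eij eqxx in neq.
Qed.

Lemma gram_low_measurement d (a : 'I_2) j k :
  hsdot (kraus (low_measurement d) a *m ket d j)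
        (kraus (low_measurement d) a *m ket d k) =
  [&& (j < d)%N, j == k & (j < 3)%N == (a == 0)]%:R.
Proof.
rewrite !low_measurement_ket.
case: ifP => [ja|]; last by rewrite hsdot0l !andbF.
case: ifP => [_|ka]; first by rewrite hsdot_ket andbT.
by rewrite hsdot0r; case: (j =P k) => [ejk|_]; [rewrite -ejk ja in ka|rewrite andbF].
Qed.

Lemma trivial_complete d : \sum_(i < 1) (1%:M : 'M[C]_d)^t* *m 1%:M = 1%:M.
Proof. by rewrite big_ord1 mulmx1 trmx1 map_mx1. Qed.

Definition trivial_measurement d : measurement C d := Measurement (trivial_complete d).

(** * The set of states and its hidden nonlocality *)

Definition hidden_states m n : {fset 'cV[C]_(m * n)} :=
  [fset psi in [seq tens s | s <- hidden_set m n]]%fset.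

Lemma hidden_statesP m n psi :
  reflect (exists2 s, s \in hidden_set m n & psi = tens s) (psi \in hidden_states m n).
Proof. by rewrite /hidden_states !finmap.inE; exact: mapP. Qed.

Lemma kraus_low_tens m n (a : 'I_2) (b : 'I_1) s :
  kraus_pair (low_measurement m) (trivial_measurement n) a b *m tens s =
  tens (kraus (low_measurement m) a *m s.1, s.2).
Proof. by rewrite /kraus_pair /tens tensmx_prod mul1mx. Qed.

Lemma hidden_states_orthogonal m n : (6 < m)%N -> (6 < n)%N ->
  orthogonal_states (hidden_states m n).
Proof.
move=> m6 n6; split.
  by apply/hidden_statesP => -[s sT]; apply/eqP; rewrite eq_sym hidden_tens_neq0.
move=> _ _ /hidden_statesP[s sT ->] /hidden_statesP[t tT ->].
have /pairwise_orth_image : pairwise (@orth C m n) [seq (1%:M *m s.1, s.2) | s <- hidden_set m n].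
  by apply: (hidden_orth (g := xpredT)) => // j k; rewrite !mul1mx hsdot_ket andbT.
by move=> /(_ s t sT tT); rewrite !mul1mx -!surjective_pairing.
Qed.

Lemma hidden_states_distinguishable m n : (6 < m)%N -> (6 < n)%N ->
  locally_distinguishable (hidden_states m n).
Proof.
move=> m6 n6; have [P idP] := hidden_distinguishable m6 n6.
by exists P => _ /hidden_statesP[s sT ->]; exact: idP.
Qed.

Lemma hidden_states_row m n k : (k < m)%N -> tens (ket m k, ket n 3) \in hidden_states m n.
Proof.
move=> km; apply/hidden_statesP; eexists; last by [].
by rewrite mem_cat (map_f (fun k => (ket m k, ket n 3))) // mem_iota.
Qed.

Lemma hidden_states_col m n k : (6 < m)%N -> (k < n)%N ->
  tens (ket m 6, ket n k) \in hidden_states m n.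
Proof.
move=> m6 kn; have [->|k3] := eqVneq k 3; first exact: hidden_states_row.
apply/hidden_statesP; eexists; last by [].
by rewrite !mem_cat (map_f (fun k => (ket m 6, ket n k))) ?orbT // mem_filter k3 mem_iota.
Qed.

Lemma hidden_states_irredundant m n : (6 < m)%N -> (6 < n)%N ->
  ~ locally_redundant (hidden_states m n).
Proof.
move=> m6 n6; have [m0 n0] : (0 < m)%N /\ (0 < n)%N by split; [case: m m6|case: n n6].
have inj d (i j : 'I_d) : i != j -> hsdot (ket d i) (ket d j) = 0.
  by move=> /negPf ij; rewrite hsdot_ket [(i : nat) == j]ij andbF.
apply: (@irredundant C m n _ m (fun i => ket m i) (ket n 3) n (ket m 6) (fun j => ket n j)).
- by rewrite -addnn -[X in (X < _)%N]addn0 ltn_add2l.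
- by rewrite -addnn -[X in (X < _)%N]addn0 ltn_add2l.
- exact: ket_neq0.
- by apply: ket_neq0; apply: leq_trans n6.
- by move=> i; apply: ket_neq0.
- by move=> i; apply: ket_neq0.
- exact: inj.
- exact: inj.
- by move=> i; apply: hidden_states_row.
- by move=> i; apply: hidden_states_col.
Qed.

Lemma hidden_OPLM m n : (6 < m)%N -> (6 < n)%N ->
  OPLM (low_measurement m) (trivial_measurement n) (hidden_states m n).
Proof.
move=> m6 n6 a b _ _ /hidden_statesP[s sT ->] /hidden_statesP[t tT ->].
rewrite !kraus_low_tens; apply: (pairwise_orth_image (F := fun s => (_ *m s.1, s.2))) sT tT.
(* Either outcome keeps exactly one of [k] and [k + 3] for each [k < 3], so all the sums to be
   compared equal 1. *)
apply: (hidden_orth m6 n6 (@gram_low_measurement m a)); by case: (a == 0).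
Qed.

Lemma post_indistinguishable m n (a : 'I_2) (b : 'I_1) : (6 < m)%N -> (6 < n)%N ->
  ~ locally_distinguishable
      (post_states (kraus_pair (low_measurement m) (trivial_measurement n) a b) (hidden_states m n)).
Proof.
move=> m6 n6.
have ltn_m k : (k < 7)%N -> (k < m)%N by move/leq_trans; apply.
have ltn_n k : (k < 7)%N -> (k < n)%N by move/leq_trans; apply.
have equi d i j k : (i < d)%N -> (j < d)%N -> (k < d)%N -> i != j -> i != k -> j != k ->
    equigram (ket d i) (ket d j) (ket d k).
  move=> id jd kd /negPf ij /negPf ik /negPf jk.
  by rewrite /equigram !hsdot_ket id jd kd !eqxx ij ik jk.
(* Outcome [a] leaves domino states on Alice's kets [c], [c + 1], [c + 2]. *)
pose c := if a == 0 then 0%N else 3%N.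
have Ex : equigram (ket m c) (ket m c.+1) (ket m c.+2).
  by rewrite /c; case: (a == 0); apply: equi; rewrite ?ltn_m.
have Ey : equigram (ket n 0) (ket n 1) (ket n 2) by apply: equi; rewrite ?ltn_n.
have x0 : ket m c != 0 by apply/ket_neq0/ltn_m; rewrite /c; case: (a == 0).
have y0 : ket n 0 != 0 by apply/ket_neq0/ltn_n.
apply: (domino_indistinguishable x0 Ex y0 Ey) => t tD.
have : t \in [seq (kraus (low_measurement m) a *m s.1, s.2) | s <- flagged_domino m n].
  move: tD; rewrite /= !mulmxDr ?mulmxN !mulmxDr !mulmxN !low_measurement_ket /= /c.
  case: (a == 0) => /=; rewrite ?(add0r, addr0, oppr0, subr0, sub0r, opprK, opprD) //.
  (* For the outcome [k >= 3] the minus signs before [ket m 5] and [ket m 3] exchange the two states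
     of each of the last two pairs; the lists then agree only as sets. *)
  rewrite /domino !inE => /or4P[|||/or4P[|||/orP[]]] ->; by rewrite ?orbT.
case/mapP=> s sD et; apply/imfsetP; exists (tens s) => /=; last by rewrite kraus_low_tens et.
rewrite inE; apply/andP; split.
  by apply/hidden_statesP; exists s; rewrite // !mem_cat sD !orbT.
by rewrite kraus_low_tens -et (domino_neq0 x0 Ex y0 Ey).
Qed.

(** The state of kets 6 and 3 is annihilated, so the post-measurement states are images of the other
    states, and taking images cannot increase their number. *)
Lemma post_card m n (b : 'I_1) : (6 < m)%N -> (6 < n)%N ->
  (#|` post_states (kraus_pair (low_measurement m) (trivial_measurement n) (ord0 : 'I_2) b)
         (hidden_states m n)|
     < #|` hidden_states m n|)%N.
Proof.
move=> m6 n6; set K := kraus_pair _ _ _ _; set psi := tens (ket m 6, ket n 3).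
have psiS : psi \in hidden_states m n by exact: hidden_states_row.
have Kpsi : K *m psi = 0.
  by rewrite kraus_low_tens low_measurement_ket /= /tens tens0mx.
rewrite (cardfsD1 psi (hidden_states m n)) psiS add1n ltnS.
apply: (@leq_trans #|` [fset K *m xi | xi in (hidden_states m n `\ psi)%fset]%fset|);
    last exact: leq_imfset_card.
apply/fsubset_leq_card/fsubsetP => phi /imfsetP[xi /=].
rewrite inE => /andP[xiS Kxi] ->; apply/imfsetP; exists xi => //=.
rewrite in_fsetD1 [_ \in _]xiS andbT; apply: contraNneq Kxi => ->.
by rewrite Kpsi.
Qed.

End HiddenSet.

Theorem theorem4 (R : realType) (m n : nat) (hm : (7 <= m)%N) (hn : (7 <= n)%N) :
  exists S : {fset 'cV[R[i]]_(m * n)},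
    [/\ orthogonal_states S,
        forall psi : 'cV[R[i]]_(m * n), psi \in S -> product_state psi &
        genuine_hidden_nonlocality_II S].
Proof.
exists (hidden_states _ m n); split; first exact: hidden_states_orthogonal.
  by move=> _ /hidden_statesP[s _ ->]; exists s.1, s.2.
split; [exact: hidden_states_distinguishable|exact: hidden_states_irredundant|].
exists (low_measurement _ m), (trivial_measurement _ n); split; first exact: hidden_OPLM.
  by move=> a b; exact: post_indistinguishable.
by exists (ord0 : 'I_2), (ord0 : 'I_1); exact: post_card.
Qed.
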